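(* Let $K$ be an algebraically closed field of characteristic different from $2$, and let $A$ and $B$ be two finite-dimensional central simple $K$-algebras with involution. Suppose that the involution of $B$ is of symplectic type and that $A$ satisfies the identities with involution of $B$, i.e. $\mathrm{Id}(B,* )\subseteq \mathrm{Id}(A,* )$. Then there exists an involution-preserving embedding of $A$ into $B$.
   Context: An involution on a $K$-algebra $A$ is a $K$-linear map $*\colon A\to A$ with $(ab)^*=b^*a^*$ and $(a^* )^*=a$. Put $A^+=\{a: a^*=a\}$ and $A^-=\{a: a^*=-a\}$. Let $K\langle Y,Z\rangle$ be the free associative algebra on countably many non-commuting variables $y_1,y_2,\dots$ (symmetric) and $z_1,z_2,\dots$ (skew-symmetric). A polynomial $f(y_1,\dots,y_p,z_1,\dots,z_q)\in K\langle Y,Z\rangle$ is an identity with involution ($*$-identity) of $(A,* )$ if $f(u_1,\dots,u_p,v_1,\dots,v_q)=0$ for all $u_i\in A^+$ and $v_j\in A^-$. The set of all $*$-identities of $(A,* )$ is denoted $\mathrm{Id}(A,* )$. A central simple algebra with involution over $K$ is of orthogonal type if it is isomorphic, as an algebra with involution, to $(M_n(K),t)$ for some $n\ge 1$, where $t$ is the transpose, and of symplectic type if it is isomorphic to $(M_{2k}(K),s)$ for some $k\geq 1$, where $a^s=Ta^tT^{-1}$ with $T=\sum_{i=1}^{k}(e_{i,i+k}-e_{i+k,i})$ ($e_{ij}$ matrix units). Every finite-dimensional central simple $K$-algebra with involution is of one of these two types. An embedding of $K$-algebras is an injective $K$-linear multiplicative map; it is not required to send the unit to the unit. An embedding $\varphi\colon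 A\to B$ of algebras with involution is involution-preserving if $\varphi(a^{*})=\varphi(a)^{*}$ for all $a\in A$ (each side using the involution of the respective algebra). *)

(* Defs.v *)
From HB Require Import structures.
From mathcomp Require Import all_boot all_order all_algebra all_field.
From mathcomp.multinomials Require Import monalg.

Set Implicit Arguments.
Unset Strict Implicit.
Unset Printing Implicit Defensive.

Import GRing.Theory.
Local Open Scope ring_scope.

Section AlgebrasWithInvolution.
Context {K : fieldType}.
Implicit Types A B : falgType K.

Definition is_involution A (star : {linear A -> A}) : Prop :=
  (forall a b, star (a * b) = star b * star a) /\ (forall a, star (star a) = a).

(* It suffices to test simplicity on subspaces: a two-sided ideal of a unital
   K-algebra is stable under scaling.  The condition A != 0 is built into
   falgType. *)
Definition is_ideal A (I : {vspace A}) : Prop :=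
  forall a x : A, x \in I -> a * x \in I /\ x * a \in I.

Definition simple_algebra A : Prop :=
  forall I : {vspace A}, is_ideal I -> I = 0%VS \/ I = fullv.

Definition central_algebra A : Prop := 'Z({:A})%VS = 1%VS.

Definition central_simple A : Prop := central_algebra A /\ simple_algebra A.

Definition symmetric_elt A (star : {linear A -> A}) (a : A) : Prop :=
  star a = a.

Definition skew_elt A (star : {linear A -> A}) (a : A) : Prop :=
  star a = - a.

(* [inl i] stands for the symmetric variable y_(i+1), [inr j] for the
   skew-symmetric variable z_(j+1); words in these variables are the elements
   of the free monoid [{fmonom (nat + nat)}]. *)
Definition freeYZ := {malg K[{fmonom (nat + nat)%type}]}.

Definition assignYZ A (u v : nat -> A) (x : nat + nat) : A :=
  match x with inl i => u i | inr j => v j end.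

Definition evalYZ A (u v : nat -> A) (f : freeYZ) : A :=
  mmap (in_alg A)
    (fun m : {fmonom (nat + nat)%type} =>
       \prod_(x <- fmonom_val m) assignYZ u v x) f.

(* Evaluating at infinite families is the same as evaluating at
   (u_1, .., u_p, v_1, .., v_q): only the variables occurring in f matter, and
   0 is both symmetric and skew. *)
Definition star_identity A (star : {linear A -> A}) (f : freeYZ) : Prop :=
  forall u v : nat -> A,
    (forall i, symmetric_elt star (u i)) -> (forall j, skew_elt star (v j)) ->
    evalYZ u v f = 0.

Definition symplectic_T (k : nat) : 'M[K]_(k + k) :=
  \sum_(i < k) (delta_mx (lshift k i) (rshift k i)
                - delta_mx (rshift k i) (lshift k i)).

Definition symplectic_inv (k : nat) (a : 'M[K]_(k + k)) : 'M[K]_(k + k) :=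
  symplectic_T k *m a^T *m invmx (symplectic_T k).

Definition symplectic_type A (star : {linear A -> A}) : Prop :=
  exists k : nat, (1 <= k)%N /\
  exists phi : {linear A -> 'M[K]_(k + k)},
    [/\ bijective phi,
        forall a b, phi (a * b) = phi a *m phi b
      & forall a, phi (star a) = symplectic_inv (phi a)].

(* Not required to send 1 to 1. *)
Definition is_embedding A B (phi : {linear A -> B}) : Prop :=
  injective phi /\ forall a b, phi (a * b) = phi a * phi b.

Definition involution_preserving A B (starA : {linear A -> A})
    (starB : {linear B -> B}) (phi : {linear A -> B}) : Prop :=
  forall a, phi (starA a) = starB (phi a).

End AlgebrasWithInvolution.

Arguments freeYZ : clear implicits.

(* Main.v *)
(* Let [B] be [M_2k] with the symplectic involution.  A symmetric element [y] of
   [B] is self-adjoint for an alternating form, so every Krylov space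
   <v, y v, y^2 v, ...> is isotropic and the minimal polynomial of [y] has degree
   at most [k].  Hence the Capelli polynomial
     sum_s sgn(s) x_0 y^(s 0) x_1 y^(s 1) ... x_k y^(s k)
   with [y] symmetric and [x_i] arbitrary (the sum of a symmetric and a skew
   variable) is a *-identity of [B], hence of [A].
   By Wedderburn [A] is [M_n], and its involution is the adjunction of a
   nondegenerate form that is symmetric or alternating.  Symmetric elements of
   [A] with n (respectively n/2) distinct eigenvalues exist and do not satisfy
   the Capelli identity once there are more than [k] of them, so n <= k
   (respectively n <= 2k).  The alternating form on K^n + K^n (respectively
   K^n) then embeds isometrically into the standard one on K^2k, and extension
   by zero on the orthogonal complement gives the embedding. *)

Require Import Defs.
From HB Require Import structures.
From Stdlib Require Import Classical.
From mathcomp Require Import all_boot all_order all_fingroup all_algebra all_field ring.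
From mathcomp.multinomials Require Import monalg.
Import GRing.Theory.
Local Open Scope ring_scope.

Set Implicit Arguments.
Unset Strict Implicit.
Unset Printing Implicit Defensive.

(** * Symmetric and alternating matrices up to congruence *)

Section Congruence.
Variables (K : fieldType).
Hypothesis two_neq0 : 2%:R != 0 :> K.

Lemma oppr_fix_eq0 (x : K) : x = - x -> x = 0.
Proof.
move/eqP; rewrite -subr_eq0 opprK -mulr2n -mulr_natl mulf_eq0 (negPf two_neq0).
by move/eqP.
Qed.

(* Subtracting a hyperbolic pair clears two rows and keeps zero rows zero, so
   counting nonzero rows plays the role of the rank. *)
Lemma alternating_sum_hyperbolic k n (H : 'M[K]_n) :
  H^T = - H -> (#|[set i | row i H != 0%R]| <= k + k)%N ->
  exists u v : 'M[K]_(k, n), H = u^T *m v - v^T *m u.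
Proof.
elim: k H => [|k IHk] H skH.
  rewrite addn0 leqn0 cards_eq0 => /eqP supp0.
  exists 0, 0; rewrite trmx0 mulmx0 subrr; apply/row_matrixP => i; rewrite row0.
  by apply/eqP/negPn; move/setP/(_ i): supp0; rewrite !inE => ->.
have skE p q : H p q = - H q p by have /matrixP/(_ q p) := skH; rewrite !mxE.
have diag0 p : H p p = 0 by apply: oppr_fix_eq0; apply: skE.
have [->|/matrix0Pn [i [j Hij]]] := eqVneq H 0.
  by exists 0, 0; rewrite trmx0 mulmx0 subrr.
move=> supp_le.
(* The factor [(H i j)^-1] makes the form of this pair agree with [H] on rows [i] and [j]. *)
pose a : 'rV_n := (H i j)^-1 *: row i H; pose b := row j H.
pose H' := H - (a^T *m b - b^T *m a).
have H'E p q : H' p q =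
    H p q - (H i j)^-1 * (H i p * H j q - H j p * H i q).
  by rewrite !mxE !big_ord1 !mxE mulrBr !mulrA [H j p * _]mulrC.
have zero_rows p : (row p H == 0) || (p == i) || (p == j) -> row p H' = 0.
  move=> Hp; apply/rowP => q; rewrite mxE H'E mxE.
  case/orP: Hp => [/orP [/eqP/rowP Hp|/eqP ->]|/eqP ->].
  - have Hp0 r : H p r = 0 by have := Hp r; rewrite !mxE.
    by rewrite (skE i p) (skE j p) !Hp0 oppr0 !mul0r subrr mulr0 subr0.
  - by rewrite diag0 mul0r sub0r (skE j i) mulNr opprK mulrA mulVf // mul1r subrr.
  - by rewrite diag0 mul0r subr0 mulrA mulVf // mul1r subrr.
have Hji : H j i != 0 by rewrite skE oppr_eq0.
have ineqj : i != j by apply: contraNneq Hij => ->; rewrite diag0.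
have row_neq0 p q : H p q != 0 -> row p H != 0.
  by apply: contraNneq => /rowP/(_ q); rewrite !mxE => ->.
have skH' : H'^T = - H'.
  apply/matrixP => p q; rewrite [LHS]mxE [RHS]mxE !H'E (skE q p).
  by rewrite -opprD -[in RHS]mulrN opprB [H i q * _]mulrC [H j q * _]mulrC.
have [] := IHk H' skH'.
  have sub : [set p | row p H' != 0] \subset [set p | row p H != 0] :\ i :\ j.
    apply/subsetP => p; rewrite !inE; apply: contraR.
    rewrite !negb_and !negbK => Hp; apply/eqP/zero_rows.
    by case/or3P: Hp => ->; rewrite ?orbT.
  apply: leq_trans (subset_leq_card sub) _.
  have := supp_le; rewrite (cardsD1 i) inE (row_neq0 i j) // (cardsD1 j) !inE.
  by rewrite (row_neq0 j i) // eq_sym ineqj addnS addSn !add1n.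
move=> u [v H'uv].
have E : H = (col_mx a u)^T *m col_mx b v - (col_mx b v)^T *m col_mx a u.
  by rewrite !tr_col_mx !mul_row_col opprD addrACA -H'uv /H' addrC subrK.
by exists (col_mx a u), (col_mx b v).
Qed.

End Congruence.

(** Induction on the rank bound: pick [x] with [x *m H *m x^T] nonzero and subtract the square of a
    linear form that agrees with [H] on [x]; the kernel then gains [x]. *)
Lemma symmetric_gram (K : closedFieldType) r n (H : 'M[K]_n) :
  2%:R != 0 :> K -> H^T = H -> (\rank H <= r)%N ->
  exists u : 'M[K]_(r, n), H = u^T *m u.
Proof.
move=> two_neq0; elim: r H => [|r IHr] H symH.
  by rewrite leqn0 mxrank_eq0 => /eqP->; exists 0; rewrite mulmx0.
move=> rkH.
have [->|H0] := eqVneq H 0; first by exists 0; rewrite mulmx0.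
have symE p q : H p q = H q p by rewrite -[in LHS]symH mxE.
(* Polarization: if [H i i] and [H j j] vanish, the form takes the value [2 * H i j] at
   [d i + d j]. *)
have [x qx] : exists x : 'rV_n, (x *m H *m x^T) 0 0 != 0.
  have [/matrix0Pn [i [j Hij]]] := H0.
  have qE (x y : 'rV_n) : ((x + y) *m H *m (x + y)^T) 0 0 =
     (x *m H *m x^T) 0 0 + (y *m H *m y^T) 0 0 + (x *m H *m y^T) 0 0 *+ 2.
    have -> : (x *m H *m y^T) 0 0 *+ 2 =
              (x *m H *m y^T) 0 0 + (y *m H *m x^T) 0 0.
      rewrite mulr2n; congr (_ + _).
      have -> : y *m H *m x^T = (x *m H *m y^T)^T.
        by rewrite !trmx_mul trmxK symH mulmxA.
      by rewrite [RHS]mxE.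
    have addE (M N : 'M[K]_1) : (M + N) 0 0 = M 0 0 + N 0 0 by rewrite mxE.
    by rewrite linearD /= !mulmxDl !mulmxDr !addE; ring.
  pose d k := delta_mx 0 k : 'rV[K]_n.
  have dE p q : (d p *m H *m (d q)^T) 0 0 = H p q.
    by rewrite -rowE trmx_delta -colE !mxE.
  have [Hii|?] := eqVneq (H i i) 0; last by exists (d i); rewrite dE.
  have [Hjj|?] := eqVneq (H j j) 0; last by exists (d j); rewrite dE.
  exists (d i + d j); rewrite qE !dE Hii Hjj !add0r -mulr_natl.
  by rewrite mulf_neq0.
set c := (x *m H *m x^T) 0 0 in qx.
have [s cs] : exists s, s ^+ 2 = c.
  have /closed_rootP [s] : size ('X^2 - c%:P : {poly K}) != 1.
    by rewrite size_XnsubC.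
  by rewrite rootE !hornerE subr_eq0 => /eqP; exists s.
have s0 : s != 0 by apply: contraNneq qx => s0; rewrite -cs s0 expr0n.
have [a aE] : exists a, a = s^-1 *: (x *m H) by eexists.
pose H' := H - a^T *m a.
have symH' : H'^T = H' by rewrite linearB /= symH trmx_mul trmxK.
have xHx : x *m H *m x^T = c%:M by rewrite [LHS]mx11_scalar.
have Ha : a^T = s^-1 *: (H *m x^T) by rewrite aE linearZ /= trmx_mul symH.
have xH' : x *m H' = 0.
  rewrite mulmxBr (mulmxA x a^T) Ha -scalemxAr mulmxA xHx -scalemxAl mul_scalar_mx aE.
  rewrite !scalerA mulrAC.
  by rewrite -invfM -expr2 cs mulVf // scale1r subrr.
have sub : (x + kermx H <= kermx H')%MS.
  rewrite addsmx_sub; apply/andP; split; apply/sub_kermxP => //.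
  by rewrite mulmxBr mulmx_ker mulmxA Ha -scalemxAr mulmxA mulmx_ker !mul0mx
             scaler0 mul0mx subrr.
have lt : (kermx H < kermx H')%MS.
  rewrite ltmxE; apply/andP; split.
    exact: submx_trans (addsmxSr _ _) sub.
  apply: contraNN qx => le; suff /sub_kermxP xH : (x <= kermx H)%MS.
    by rewrite /c xH mul0mx mxE.
  by apply: submx_trans le; apply: submx_trans sub; apply: addsmxSl.
have rkH' : (\rank H' <= r)%N.
  have := rank_ltmx lt; rewrite !mxrank_ker => lt_rk.
  rewrite -ltnS; apply: leq_trans rkH; rewrite ltnNge.
  by apply: contraTN lt_rk => le; rewrite -leqNgt leq_sub2l.
have [u H'u] := IHr H' symH' rkH'.
have E : H = (col_mx a u)^T *m col_mx a u.
  by rewrite tr_col_mx mul_row_col -H'u addrC subrK.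
by exists (col_mx a u).
Qed.

(** * Self-adjoint matrices for an alternating form *)

Section SelfAdjoint.
Variable K : closedFieldType.

(* The vectors (1, x, x^2, ...) suffice: each matrix excludes finitely many x. *)
Lemma exists_common_nonkernel n (s : seq 'M[K]_n) :
  all (fun M => M != 0) s -> exists v : 'rV[K]_n, all (fun M => v *m M != 0) s.
Proof.
move=> s_neq0.
have colP (M : 'M[K]_n) : M != 0 -> exists j, rVpoly (col j M)^T != 0.
  case/matrix0Pn=> i [j Mij]; exists j; apply: contraNneq Mij => /polyP/(_ i).
  by rewrite coef_rVpoly_ord coef0 !mxE => ->.
have [p p_neq0 pP] : exists2 p : {poly K}, p != 0 &
    forall x, ~~ root p x -> all (fun M => \row_i x ^+ (i : 'I_n) *m M != 0) s.
  elim: s s_neq0 => [_|M s IHs /andP [M0 /IHs [p p0 pP]]].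
    by exists 1; first exact: oner_neq0.
  have [j q0] := colP M M0.
  exists (rVpoly (col j M)^T * p); first by rewrite mulf_neq0.
  move=> x; rewrite rootM negb_or => /andP [qx /pP px]; apply/andP; split=> //.
  apply: contraNneq qx => /rowP/(_ j); rewrite !mxE => sum0.
  rewrite rootE horner_poly -[X in _ == X]sum0; apply/eqP.
  by apply: eq_bigr => i _; rewrite valK !mxE mulrC.
by have /closed_nonrootP [x /pP] := p_neq0; exists (\row_i x ^+ (i : 'I_n)).
Qed.

(** Any [v] outside the kernels of all [(m / (X - z))(y)], [z] a root of the minimal polynomial [m],
    will do: the gcd of [m] with a polynomial annihilating [v] divides no [m / (X - z)], so it is
    [m] up to a scalar. *)
Lemma exists_maximal_vector n (y : 'M[K]_n.+1) :
  exists v : 'rV[K]_n.+1, forall p : {poly K},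
    v *m horner_mx y p = 0 -> horner_mx y p = 0.
Proof.
set m := mxminpoly y.
have m_mon : m \is monic := mxminpoly_monic y.
have [r mr] := closed_field_poly_normal m.
have [|v /allP vP] := @exists_common_nonkernel _
  [seq horner_mx y (m %/ ('X - z%:P)) | z <- r].
  apply/allP => M /mapP [z zr ->]; apply/eqP => /mxminpoly_min.
  have mz : ('X - z%:P) %| m.
    rewrite dvdp_XsubCl mr rootZ ?root_prod_XsubC //.
    by rewrite lead_coef_eq0 monic_neq0.
  move/dvdp_leq; rewrite -/m => le.
  have := le; rewrite dvdp_div_eq0 // monic_neq0 // => /(_ isT).
  rewrite size_divp ?polyXsubC_eq0 // size_XsubC subn1 leqNgt.
  by rewrite prednK ?leqnn // size_poly_gt0 monic_neq0.
exists v => p vp.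
suff /dvdpP [q ->] : m %| p by rewrite rmorphM /= mx_root_minpoly mulr0.
pose g := gcdp p m.
have hornerM a b : horner_mx y (a * b) = horner_mx y a *m horner_mx y b.
  by rewrite rmorphM.
have vg : v *m horner_mx y g = 0.
  have [u /(eqp_dvdl g)] := Bezoutp p m; rewrite dvdpp => /dvdpP [c ->].
  have -> : c * (u.1 * p + u.2 * m) = p * (c * u.1) + m * (c * u.2).
    by rewrite mulrDr !mulrA [c * u.1 * p]mulrC [c * u.2 * m]mulrC !mulrA.
  rewrite rmorphD /= (hornerM p) (hornerM m) mulmxDr.
  by rewrite mx_root_minpoly mul0mx mulmx0 addr0 mulmxA vp mul0mx.
have /dvdpP [h mE] : g %| m := dvdp_gcdr p m.
have h0 : h != 0.
  by apply: contraTneq m_mon => h0; rewrite mE h0 mul0r monicE lead_coef0 eq_sym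
     oner_eq0.
apply: dvdp_trans (dvdp_gcdl p m); rewrite -/g.
case: (boolP (size h == 1%N)) => [/size_poly1P [c c0 hE]|/closed_rootP [z hz]].
  by rewrite mE hE mul_polyC dvdpZl.
have /factor_theorem [h' h'E] := hz.
have zr : z \in r.
  have : root m z by rewrite mE rootM hz.
  by rewrite mr rootZ ?root_prod_XsubC // lead_coef_eq0 monic_neq0.
have /vP /eqP [] : horner_mx y (m %/ ('X - z%:P)) \in
    [seq horner_mx y (m %/ ('X - z%:P)) | z <- r] by apply/mapP; exists z.
rewrite mE h'E mulrAC mulpK ?polyXsubC_eq0 // mulrC hornerM mulmxA vg.
by rewrite mul0mx.
Qed.

(* The Krylov space of [v] is isotropic for the alternating form [T]. *)
Lemma degree_mxminpoly_self_adjoint n (y T : 'M[K]_n.+1) :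
  2%:R != 0 :> K -> T \in unitmx -> T^T = - T -> y *m T = T *m y^T ->
  (degree_mxminpoly y + degree_mxminpoly y <= n.+1)%N.
Proof.
move=> two0 unitT skT yT; set d := degree_mxminpoly y.
have [v vP] := exists_maximal_vector y.
have yTX i : y ^+ i *m T = T *m (y ^+ i)^T.
  elim: i => [|i IHi]; first by rewrite expr0 trmx1 mul1mx mulmx1.
  by rewrite exprS -mulmxE -mulmxA IHi mulmxA yT -mulmxA -trmx_mul mulmxE -exprSr exprS.
(* This 1 by 1 matrix is its own negative, since powers of [y] pass through [T] and [T] is skew. *)
have isotropic i : v *m y ^+ i *m T *m v^T = 0.
  set M := _ *m v^T.
  have MT : M^T = - M.
    by rewrite !trmx_mul trmxK skT !mulmxA mulmxN !mulNmx -(mulmxA v) -yTX !mulmxA.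
  apply/matrixP => a b; rewrite !ord1 [RHS]mxE; apply: (oppr_fix_eq0 two0).
  by have /matrixP/(_ 0 0) := MT; rewrite [LHS]mxE [RHS]mxE.
pose W : 'M_(d, n.+1) := \matrix_(i < d) (v *m y ^+ i).
have rowW i : row i W = v *m y ^+ i by rewrite rowK.
have WTW : W *m (T *m W^T) = 0.
  apply/matrixP => i j; rewrite [RHS]mxE.
  have -> : (W *m (T *m W^T)) i j = (row i W *m T *m (row j W)^T) 0 0.
    rewrite -row_mul mulmxA [LHS]mxE [RHS]mxE; apply: eq_bigr => l _.
    by congr (_ * _); rewrite !mxE.
  rewrite !rowW trmx_mul !mulmxA -(mulmxA _ T) -yTX !mulmxA -(mulmxA v) mulmxE.
  by rewrite -exprD isotropic mxE.
(* A dependency among the rows is a polynomial of degree below [d] annihilating [v], hence [y],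
   hence zero. *)
have rkW : \rank W = d.
  apply/eqP; change (row_free W); rewrite -kermx_eq0; apply/rowV0P => c.
  move/sub_kermxP => cW0.
  have : v *m horner_mx y (rVpoly c) = 0.
    rewrite -[RHS]cW0 [in LHS](row_sum_delta c) [RHS]mulmx_sum_row.
    rewrite linear_sum rmorph_sum /= (mulmx_sumr v).
    apply: eq_bigr => i _; rewrite linearZ /= horner_mxZ -scalemxAr rVpoly_delta rmorphXn /=.
    by rewrite horner_mx_X rowW.
  move/vP=> c0; apply: (@horner_rVpoly_inj _ _ y).
  by rewrite /= c0 !linear0.
(* The ranks of [W] and [T *m W^T] are both [d] and add up to at most [n.+1]. *)
have := mulmx0_rank_max WTW.
by rewrite -(mxrank_tr (T *m _)) trmx_mul trmxK mxrankMfree ?row_free_unit ?unitmx_tr // rkW.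
Qed.

End SelfAdjoint.

(** * Simple algebras over an algebraically closed field *)

Lemma linear_pack (R : pzRingType) (U V : lmodType R) (f : U -> V) :
  linear f -> exists g : {linear U -> V}, g =1 f.
Proof.
move=> f_lin.
by exists (HB.pack_for {linear U -> V} f (GRing.isLinear.Build R U V _ f f_lin)).
Qed.

Section Wedderburn.
Variables (K : closedFieldType) (A : falgType K).
Hypothesis simpleA : simple_algebra A.

Definition left_ideal (L : {vspace A}) := ({:A} * L <= L)%VS.

Lemma exists_minimal_left_ideal : exists L : {vspace A},
  [/\ left_ideal L, L != 0%VS &
      forall L' : {vspace A}, left_ideal L' -> L' != 0%VS -> (L' <= L)%VS -> L' = L].
Proof.
suff main d : forall L : {vspace A}, left_ideal L -> L != 0%VS -> (\dim L <= d)%N ->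
    exists L : {vspace A}, [/\ left_ideal L, L != 0%VS &
      forall L' : {vspace A}, left_ideal L' -> L' != 0%VS -> (L' <= L)%VS -> L' = L].
  apply: (main _ fullv) (leqnn _); first exact: subvf.
  by rewrite -dimv_eq0 -lt0n adim_gt0.
elim: d => [|d IHd] L idL L0 dL.
  by move: L0; rewrite -dimv_eq0 -leqn0 dL.
have [[L' [idL' L'0 sL'L neL'L]]|minL] := classic (exists L' : {vspace A},
    [/\ left_ideal L', L' != 0%VS, (L' <= L)%VS & L' <> L]).
  apply: (IHd L') => //; rewrite -ltnS; apply: leq_trans dL.
  rewrite ltn_neqAle dimvS // andbT; apply/eqP => dimE; apply: neL'L.
  by apply/eqP; rewrite eqEdim sL'L dimE leqnn.
exists L; split=> // L' idL' L'0 sL'L.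
by apply: NNPP => neL'L; apply: minL; exists L'.
Qed.

Section MinimalLeftIdeal.
Variable L : {vspace A}.
Hypotheses (idL : left_ideal L) (L_neq0 : L != 0%VS).
Hypothesis minL : forall L' : {vspace A},
  left_ideal L' -> L' != 0%VS -> (L' <= L)%VS -> L' = L.

Lemma left_idealM a l : l \in L -> a * l \in L.
Proof. by move=> Ll; apply: (subvP idL); rewrite memv_mul ?memvf. Qed.

(** Simplicity applies because the product is a two-sided ideal containing the nonzero [L].
    Faithfulness of the left action on [L] follows. *)
Lemma left_ideal_full : (L * {:A})%VS = fullv.
Proof.
have [||//] := @simpleA (L * {:A})%VS.
  move=> a x Ix; split; last first.
    by apply: (subvP (_ : (L * {:A} * {:A} <= _)%VS));
      rewrite ?memv_mul ?memvf // -prodvA prodvSr ?subvf.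
  apply: (subvP (_ : ({:A} * (L * {:A}) <= _)%VS));
    by rewrite ?memv_mul ?memvf // prodvA prodvSl.
move=> LA0; case/negP: L_neq0; rewrite -subv0 -LA0; apply/subvP => l Ll.
by rewrite -[l]mulr1 memv_mul ?memvf.
Qed.

Lemma left_ideal_faithful a : (forall l, l \in L -> a * l = 0) -> a = 0.
Proof.
move=> aL0; have: 1 \in (L * {:A})%VS by rewrite left_ideal_full memvf.
suff /subvP sub : (L * {:A} <= lker (amull a))%VS.
  by move/sub; rewrite memv_ker lfunE /= mulr1 => /eqP.
apply/prodvP => l b Ll _; rewrite memv_ker lfunE /=.
by rewrite mulrA aL0 // mul0r.
Qed.

(* Schur: an eigenspace of right multiplication by [w] is a left ideal. *)
Lemma right_mul_scalar w : w \in L ->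
  exists c, forall l, l \in L -> l * w = c *: l.
Proof.
move=> Lw; pose X := vbasis L; pose n := \dim L.
pose M : 'M[K]_n := \matrix_(i, j) coord X j (X`_i * w).
have n_gt0 : (0 < n)%N by rewrite lt0n dimv_eq0.
have XL (i : 'I_n) : X`_i \in L by rewrite vbasis_mem ?mem_nth ?size_tuple.
have XwE (i : 'I_n) : X`_i * w = \sum_j M i j *: X`_j.
  rewrite [LHS](coord_vbasis (left_idealM _ Lw)).
  by apply: eq_bigr => j _; rewrite mxE.
have /closed_rootP [c] : size (char_poly M) != 1%N.
  by rewrite size_char_poly eqSS -lt0n.
rewrite -eigenvalue_root_char => /eigenvalueP [v vM v0].
pose l0 := \sum_i v 0 i *: X`_i.
have l0w : l0 * w = c *: l0.
  rewrite mulr_suml scaler_sumr.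
  under eq_bigr => i _ do rewrite -scalerAl XwE scaler_sumr.
  rewrite exchange_big /=; apply: eq_bigr => j _.
  under eq_bigr => i _ do rewrite scalerA.
  rewrite -scaler_suml scalerA; congr (_ *: _).
  by have /rowP/(_ j) := vM; rewrite !mxE => <-.
have Ll0 : l0 \in L by rewrite memv_suml // => i _; rewrite memvZ.
have l00 : l0 != 0.
  apply: contraNneq v0 => l00; apply/eqP/rowP => i; rewrite mxE.
  have /freeP := basis_free (vbasisP L); apply => //.
pose h : 'End(A) := amulr w - c *: \1%VF.
pose L' := (L :&: lker h)%VS.
have L'P x : (x \in L') = (x \in L) && (x * w == c *: x).
  rewrite memv_cap memv_ker -[x * w == _]subr_eq0; congr (_ && (_ == 0)).
  by rewrite add_lfunE opp_lfunE scale_lfunE id_lfunE lfunE.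
exists c => l Ll; suff : l \in L' by rewrite L'P => /andP [_ /eqP].
rewrite (minL (L' := L')) //; last by rewrite capvSl.
  apply/prodvP => a x _; rewrite !L'P => /andP [Lx /eqP xw].
  by rewrite left_idealM //= -mulrA xw scalerAr.
apply: contraNneq l00 => L'0; rewrite -memv0 -L'0 L'P Ll0 /=; exact/eqP.
Qed.

(** Faithfulness yields a nonzero product [l * w] in [L]; right multiplication by [w] is then a
    nonzero scalar on [L], and rescaling [w] makes it the identity. *)
Lemma exists_right_unit : exists2 e, e \in L & forall l, l \in L -> l * e = l.
Proof.
have [[w [l [Lw Ll lw]]]|LL0] := classic (exists w, exists l,
    [/\ w \in L, l \in L & l * w <> 0]).
  have [c cP] := right_mul_scalar Lw.
  have c0 : c != 0 by apply/eqP => c0; apply: lw; rewrite cP // c0 scale0r.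
  exists (c^-1 *: w) => [|x Lx]; first exact: memvZ.
  by rewrite -scalerAr cP // scalerA mulVf // scale1r.
case/negP: L_neq0; rewrite -subv0; apply/subvP => l Ll; rewrite memv0.
apply/eqP/left_ideal_faithful => l' Ll'.
by apply: NNPP => ll'; apply: LL0; exists l', l.
Qed.

(** [rho] is left multiplication on [L] in a basis, injective by faithfulness. Surjectivity comes
    from elements dual to the basis under the pairing [e * (a * l)], whose values lie on the line of
    [e]. *)
Lemma minimal_left_ideal_matrix : exists n (rho : {linear A -> 'M[K]_n}),
  [/\ (0 < n)%N, bijective rho & forall a b, rho (a * b) = rho a *m rho b].
Proof.
pose n := \dim L; pose X := vbasis L.
have XL (i : 'I_n) : X`_i \in L by rewrite vbasis_mem ?mem_nth ?size_tuple.
pose f (a : A) : 'M[K]_n := \matrix_(i, j) coord X i (a * X`_j).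
have f_lin : linear f.
  by move=> c a b; apply/matrixP => i j; rewrite !mxE mulrDl -scalerAl linearP.
have [rho rhoE] := linear_pack f_lin.
have rhoX a (j : 'I_n) : a * X`_j = \sum_i rho a i j *: X`_i.
  rewrite [LHS](coord_vbasis (left_idealM _ (XL _))).
  by apply: eq_bigr => i _; rewrite rhoE mxE.
have rho_eq a (M : 'M[K]_n) : (forall j : 'I_n, a * X`_j = \sum_i M i j *: X`_i) -> rho a = M.
  move=> aX; apply/matrixP => i j; rewrite rhoE mxE aX.
  by rewrite coord_sum_free // (basis_free (vbasisP L)).
have rho_inj : injective rho.
  move=> a b ab; apply/eqP; rewrite -subr_eq0; apply/eqP/left_ideal_faithful => l Ll.
  rewrite (coord_vbasis Ll) mulr_sumr big1 // => j _.
  by rewrite -scalerAr mulrBl !rhoX ab subrr scaler0.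
have [e Le eP] := exists_right_unit.
have e0 : e != 0.
  apply: contraNneq L_neq0 => e0; rewrite -subv0; apply/subvP => l Ll.
  by rewrite -[l]eP // e0 mulr0 mem0v.
have [mu mu_e] : exists mu : {scalar A}, mu e = 1.
  by exists (coord [tuple e] 0); apply: (coord_free 0 0 (X := [tuple e])); rewrite seq1_free.
have muE a l : l \in L -> e * (a * l) = mu (e * (a * l)) *: e.
  move=> Ll; have [c cP] := right_mul_scalar (left_idealM a Ll).
  by rewrite cP // linearZ /= mu_e mulr1.
pose N := \dim {:A}; pose b := vbasis {:A}.
pose Q : 'M[K]_(N, n) := \matrix_(i, j) mu (e * (b`_i * X`_j)).
(* The pairing has no kernel in [L]: a nonzero [m] in it would generate [L] by minimality, forcing
   [e * e = 0], against [e * e = e]. *)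
have /row_fullP [R RQ] : row_full Q.
  rewrite /row_full -mxrank_tr; change (is_true (row_free Q^T)); rewrite -kermx_eq0.
  apply/rowV0P => v /sub_kermxP vQ.
  pose m := \sum_j v 0 j *: X`_j.
  have Lm : m \in L by rewrite memv_suml // => i _; rewrite memvZ.
  have eAm a : e * (a * m) = 0.
    rewrite (coord_vbasis (memvf a)) mulr_suml mulr_sumr big1 // => i _.
    rewrite -scalerAl -scalerAr muE // -/b.
    suff -> : mu (e * (b`_i * m)) = (v *m Q^T) 0 i by rewrite vQ mxE scale0r scaler0.
    rewrite !mulr_sumr linear_sum mxE; apply: eq_bigr => j _.
    by rewrite -!scalerAr linearZ !mxE.
  have m0 : m = 0.
    apply: NNPP => /eqP m0.
    have Am : ({:A} * <[m]>)%VS = L.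
      apply: minL.
      - by rewrite /left_ideal prodvA prodvSl ?subvf.
      - apply: contraNneq m0 => Am0.
        by have := memv_mul (memvf 1) (memv_line m); rewrite mul1r Am0 memv0.
      - by apply/prodvP => a x _ /vlineP [c ->]; rewrite left_idealM ?memvZ.
    case/negP: e0; rewrite -[e]eP //.
    suff /subvP /(_ e) : ({:A} * <[m]> <= lker (amull e))%VS.
      by rewrite Am Le memv_ker lfunE => /(_ isT).
    apply/prodvP => a x _ /vlineP [c ->]; rewrite memv_ker lfunE /=.
    by rewrite -scalerAr -scalerAr eAm scaler0.
  apply/rowP => i; rewrite mxE.
  by have /freeP := basis_free (vbasisP L); apply.
pose r j := \sum_i R j i *: b`_i.
have rX (j k : 'I_n) : e * (r j * X`_k) = (j == k)%:R *: e.
  rewrite muE //; congr (_ *: _).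
  transitivity ((R *m Q) j k); last by rewrite RQ mxE.
  rewrite mulr_suml mulr_sumr linear_sum mxE; apply: eq_bigr => i _.
  by rewrite -scalerAl -scalerAr linearZ mxE.
(* [X_i * (e * r j)] maps [X_j] to [X_i] and the other basis vectors to zero, so it acts as a matrix
   unit. *)
pose g (M : 'M[K]_n) := \sum_i \sum_j M i j *: (X`_i * (e * r j)).
have rhog M : rho (g M) = M.
  apply: rho_eq => k; rewrite mulr_suml; apply: eq_bigr => i _.
  rewrite mulr_suml (bigD1 k) //= big1 => [|j jk].
    by rewrite -scalerAl -!mulrA rX eqxx scale1r eP // addr0.
  by rewrite -scalerAl -!mulrA rX (negPf jk) scale0r mulr0 scaler0.
exists n, rho; split; first by rewrite lt0n dimv_eq0.
  by exists g => // a; apply: rho_inj; rewrite rhog.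
move=> a c; apply: rho_eq => j; rewrite -mulrA rhoX mulr_sumr.
under eq_bigr => i _ do rewrite -scalerAr rhoX scaler_sumr.
rewrite exchange_big /=; apply: eq_bigr => i _.
rewrite mxE scaler_suml; apply: eq_bigr => l _.
by rewrite scalerA mulrC.
Qed.

End MinimalLeftIdeal.

Lemma simple_algebra_matrix : exists n (rho : {linear A -> 'M[K]_n}),
  [/\ (0 < n)%N, bijective rho & forall a b, rho (a * b) = rho a *m rho b].
Proof.
have [L [idL L0 minL]] := exists_minimal_left_ideal.
exact: (minimal_left_ideal_matrix idL L0 minL).
Qed.

End Wedderburn.

(** * Involutions of matrix algebras *)

Lemma matrix_center_scalar (R : nzRingType) n (Z : 'M[R]_n) (i0 : 'I_n) :
  (forall a, a *m Z = Z *m a) -> Z = (Z i0 i0)%:M.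
Proof.
move=> ZC; apply/matrixP => k i.
have /matrixP/(_ k i0) := ZC (delta_mx i i0).
rewrite -[delta_mx i i0](mul_delta_mx (0 : 'I_1)) -mulmxA -rowE mulmxA -colE.
by rewrite !mxE !big_ord1 !mxE !eqxx !andbT /= mulr1 => <-; rewrite mulr_natl.
Qed.

Section MatrixInvolution.
Variables (K : fieldType) (n : nat) (tau : {linear 'M[K]_n -> 'M[K]_n}).
Hypothesis tauM : forall a b, tau (a *m b) = tau b *m tau a.
Hypothesis tauK : forall a, tau (tau a) = a.
Hypothesis n_gt0 : (0 < n)%N.

(* The intertwiner of [tau] with transposition is read off one column of the
   images of the matrix units of one row. *)
Lemma matrix_involution_adjoint : exists H : 'M[K]_n,
  [/\ H \in unitmx, forall a, tau a *m H = H *m a^T & H^T = H \/ H^T = - H].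
Proof.
pose i0 := Ordinal n_gt0.
have deltaM j (a : 'M[K]_n) : delta_mx i0 j *m a = \sum_l a j l *: delta_mx i0 l.
  rewrite -(mul_delta_mx (0 : 'I_1)) -mulmxA -rowE [row j a]row_sum_delta.
  rewrite mulmx_sumr; apply: eq_bigr => l _.
  by rewrite -scalemxAr mul_delta_mx mxE.
have /matrix0Pn [p0 [q tau_neq0]] : tau (delta_mx i0 i0) != 0.
  apply/eqP => tau0; have := tauK (delta_mx i0 i0); rewrite tau0 linear0.
  by move/matrixP/(_ i0 i0); rewrite !mxE !eqxx => /esym/eqP; rewrite oner_eq0.
pose H := \matrix_(p, j) tau (delta_mx i0 j) p q.
have tauH a : tau a *m H = H *m a^T.
  apply/matrixP => p j; rewrite !mxE.
  transitivity (tau (delta_mx i0 j *m a) p q).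
    by rewrite tauM mxE; apply: eq_bigr => r _; rewrite mxE.
  rewrite deltaM linear_sum summxE; apply: eq_bigr => l _.
  by rewrite linearZ !mxE mulrC.
have H0 : H != 0.
  by apply: contraNneq tau_neq0 => /matrixP/(_ p0 i0); rewrite !mxE => ->.
(* If [H] kills a nonzero [v^T], so does every [H *m a^T = tau a *m H]; matrix units [a] then force
   [H = 0]. *)
have unitH : H \in unitmx.
  rewrite -unitmx_tr -row_free_unit -kermx_eq0; apply/rowV0P => v.
  move/sub_kermxP/(congr1 trmx); rewrite trmx_mul trmxK trmx0 => Hv.
  apply/eqP; apply: contraNT H0 => /matrix0Pn [z [i vi]]; rewrite ord1 in vi.
  apply/eqP/matrixP => p j; rewrite [RHS]mxE.
  have : H *m (delta_mx i j)^T *m v^T = 0 by rewrite -tauH -mulmxA Hv mulmx0.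
  rewrite trmx_delta -(mul_delta_mx (0 : 'I_1)) -!mulmxA -rowE mulmxA -colE.
  move/matrixP/(_ p 0); rewrite !mxE big_ord1 !mxE => /eqP.
  by rewrite mulf_eq0 (negPf vi) orbF => /eqP.
have unitHT : H^T \in unitmx by rewrite unitmx_tr.
(* Applying [tau] twice shows that [Z] commutes with every matrix. Hence [H] is a scalar multiple of
   [H^T], and transposing twice makes that scalar square to 1. *)
pose Z := H *m invmx H^T.
have ZC a : a *m Z = Z *m a.
  have E : a *m H = Z *m a *m H^T.
    have tauT : H^T *m (tau a)^T = a *m H^T.
      by rewrite -trmx_mul tauH trmx_mul trmxK.
    by rewrite -{1}[a]tauK tauH -[(tau a)^T](mulKmx unitHT) tauT !mulmxA.
  by rewrite mulmxA E mulmxK.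
have HZ : H = Z i0 i0 *: H^T.
  by rewrite -mul_scalar_mx -matrix_center_scalar // mulmxKV.
set z := Z i0 i0 in HZ.
have HT : H^T = z *: H by rewrite [in LHS]HZ linearZ /= trmxK.
have zz : z ^+ 2 = 1.
  have : H = (z * z) *: H by rewrite -scalerA -HT -HZ.
  move/eqP; rewrite -{1}[H]scale1r -subr_eq0 -scalerBl scaler_eq0 (negPf H0) orbF.
  by rewrite subr_eq0 => /eqP.
exists H; split=> //.
move/eqP: zz; rewrite sqrf_eq1 => /orP [] /eqP zE; [left|right].
  by rewrite HT zE scale1r.
by rewrite HT zE scaleN1r.
Qed.

End MatrixInvolution.

Section SymplecticMatrix.
Variables (K : fieldType) (k : nat).
Local Notation T := (symplectic_T (K := K) k).

Lemma symplectic_T_block : T = block_mx 0 1%:M (- 1%:M) 0.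
Proof.
have sum_delta (f g : 'I_k -> 'I_(k + k)) a b : injective f -> injective g ->
    \sum_i delta_mx (f i) (g i) (f a) (g b) = (a == b)%:R :> K.
  move=> f_inj g_inj; rewrite (bigD1 a) //= big1 => [|i ia].
    by rewrite mxE eqxx (inj_eq g_inj) addr0 eq_sym.
  by rewrite mxE (inj_eq f_inj) eq_sym (negPf ia).
apply/matrixP => i j; rewrite /symplectic_T sumrB 2!mxE !summxE.
case: (split_ordP i) => a ->; case: (split_ordP j) => b ->.
- by rewrite block_mxEul !big1 ?mxE ?subrr // => c _; rewrite mxE ?eq_lrshift ?eq_rlshift ?andbF.
- rewrite block_mxEur sum_delta ?[X in _ - X]big1; last 3 first.
  + by move=> c _; rewrite mxE eq_lrshift.
  + exact: lshift_inj.
  + exact: rshift_inj.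
  by rewrite subr0 mxE.
- rewrite block_mxEdl sum_delta ?[X in X - _]big1; last 3 first.
  + by move=> c _; rewrite mxE eq_rlshift.
  + exact: rshift_inj.
  + exact: lshift_inj.
  by rewrite sub0r !mxE.
- by rewrite block_mxEdr !big1 ?mxE ?subrr // => c _; rewrite mxE ?eq_lrshift ?eq_rlshift ?andbF.
Qed.

Lemma tr_symplectic_T : T^T = - T.
Proof.
by rewrite symplectic_T_block tr_block_mx opp_block_mx !trmx0 !linearN /= trmx1
  !opprK oppr0.
Qed.

Lemma symplectic_T_sqr : T *m T = - 1%:M.
Proof.
rewrite symplectic_T_block mulmx_block !mulmx0 !mul0mx !mulmxN !mulNmx !mulmx1.
by rewrite !addr0 !add0r scalar_mx_block opp_block_mx !oppr0.
Qed.

Lemma symplectic_T_unit : T \in unitmx.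
Proof.
suff /mulmx1_unit [] : T *m - T = 1%:M by [].
by rewrite mulmxN symplectic_T_sqr opprK.
Qed.

Lemma symplectic_T_inv : invmx T = - T.
Proof.
by rewrite -[RHS](mulKmx symplectic_T_unit) mulmxN symplectic_T_sqr opprK mulmx1.
Qed.

(** Turns the hyperbolic sums of [alternating_sum_hyperbolic] into pullbacks of the standard form
    along [col_mx u v]. *)
Lemma symplectic_T_gram n (u v : 'M[K]_(k, n)) :
  (col_mx u v)^T *m T *m col_mx u v = u^T *m v - v^T *m u.
Proof.
rewrite symplectic_T_block tr_col_mx mul_row_block !mulmx0 mulmxN !mulmx1.
by rewrite add0r addr0 mul_row_col mulNmx addrC.
Qed.

End SymplecticMatrix.

(** * The Capelli polynomial on powers *)

(** The Capelli polynomial at the powers [1, y, ..., y^(k-1)], without a trailing separator. Any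
    ring is allowed, so that one expression serves in the free algebra, in [A] and in matrices. *)
Definition capelli_powers (R : pzRingType) k (x : nat -> R) (y : R) : R :=
  \sum_(s : 'S_k) (-1) ^+ s * \prod_(i < k) (x i * y ^+ s i).

(** [inl 0] is kept for [y], so the symmetric parts of the separators start at [inl 1]. *)
Definition capelli_identity (K : fieldType) k : freeYZ K :=
  capelli_powers k (fun i => << fmu (inl i.+1) >> + << fmu (inr i) >>)
    << fmu (inl 0%N) >>.

Lemma eq_capelli_powers (R : pzRingType) k (x1 x2 : nat -> R) y :
  x1 =1 x2 -> capelli_powers k x1 y = capelli_powers k x2 y.
Proof.
move=> x12; apply: eq_bigr => s _; congr (_ * _).
by apply: eq_bigr => i _; rewrite x12.
Qed.

Lemma rmorph_capelli_powers (R S : pzRingType) (f : {rmorphism R -> S}) k x y :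
  f (capelli_powers k x y) = capelli_powers k (f \o x) (f y).
Proof.
rewrite rmorph_sum; apply: eq_bigr => s _.
rewrite rmorphM rmorph_sign rmorph_prod; congr (_ * _); apply: eq_bigr => i _.
by rewrite rmorphM rmorphXn.
Qed.

Section Capelli.
Variable K : fieldType.
Implicit Type A : falgType K.

Lemma evalYZ_rmorphism A (u v : nat -> A) :
  exists phi : {rmorphism freeYZ K -> A}, phi =1 evalYZ u v.
Proof.
pose h (m : {fmonom (nat + nat)%type}) := \prod_(x <- fmonom_val m) assignYZ u v x.
have hM : mmorphism h.
  by split=> [m1 m2|]; rewrite /h ?fmM ?big_cat // fm1 big_nil.
pose h' : {mmorphism {fmonom (nat + nat)%type} -> A} :=
  HB.pack h (isMultiplicative.Build _ _ h hM).
have ev_mul : multiplicative (mmap (in_alg A) h').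
  apply: commr_mmap_is_multiplicative => g m m'; rewrite /GRing.comm /=.
  by rewrite -scalerAl -scalerAr mul1r mulr1.
by exists (HB.pack_for {rmorphism freeYZ K -> A} (mmap (in_alg A) h')
  (GRing.isMultiplicative.Build _ _ (mmap (in_alg A) h') ev_mul)).
Qed.

Lemma evalYZ_capelli A (u v : nat -> A) k :
  evalYZ u v (capelli_identity K k) =
  capelli_powers k (fun i => u i.+1 + v i) (u 0%N).
Proof.
have [phi phiE] := evalYZ_rmorphism u v.
have phiU x : phi << fmu x >> = assignYZ u v x.
  by rewrite phiE /evalYZ mmapU /= scale1r mul1r fmU big_seq1.
rewrite -phiE rmorph_capelli_powers phiU; apply: eq_capelli_powers => i.
by rewrite /= rmorphD /= !phiU.
Qed.

Lemma star_identity_capelli A (star : {linear A -> A}) k :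
  2%:R != 0 :> K -> (forall a, star (star a) = a) ->
  star_identity star (capelli_identity K k) <->
  (forall (x : nat -> A) y, star y = y -> capelli_powers k x y = 0).
Proof.
move=> two0 starK; split=> [idf x y sy | van u v su sv]; last first.
  by rewrite evalYZ_capelli van // su.
(* Symmetric and skew parts of [x i]; the index shift leaves [u 0] for [y]. *)
pose u i := if i is i'.+1 then 2%:R^-1 *: (x i' + star (x i')) else y.
pose v i := 2%:R^-1 *: (x i - star (x i)).
have := idf u v; rewrite evalYZ_capelli => E.
transitivity (capelli_powers k (fun i => u i.+1 + v i) (u 0%N)).
  apply: eq_capelli_powers => i.
  rewrite /u /v -scalerDr addrACA subrr addr0 -mulr2n -scaler_nat scalerA.
  by rewrite mulVf // scale1r.
apply: E => [[|i]|i] //; rewrite /symmetric_elt /skew_elt /= linearZ /=.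
  by rewrite linearD /= starK addrC.
by rewrite linearB /= starK -scalerN opprB.
Qed.

(* Expanding each power of [y] in the [k] elements [b] leaves minors of a
   matrix with two equal columns. *)
Lemma capelli_powers_dependent A k (x : nat -> A) y (b : 'I_k -> A)
    (C : 'M[K]_(k.+1, k)) :
  (forall i : 'I_k.+1, y ^+ i = \sum_j C i j *: b j) ->
  capelli_powers k.+1 x y = 0.
Proof.
move=> yE.
have prodE (s : 'S_k.+1) : \prod_(i < k.+1) (x i * y ^+ s i) =
    \sum_(f : {ffun 'I_k.+1 -> 'I_k})
      (\prod_(i < k.+1) C (s i) (f i)) *: \prod_(i < k.+1) (x i * b (f i)).
  under eq_bigr => i _ do rewrite yE mulr_sumr.
  rewrite bigA_distr_bigA; apply: eq_bigr => f _; rewrite -scaler_prod.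
  by apply: eq_bigr => i _; rewrite scalerAr.
rewrite /capelli_powers.
under eq_bigr => s _ do rewrite prodE mulr_sumr.
rewrite exchange_big big1 //= => f _.
have [inj_f|] := boolP (injectiveb f).
  by have := leq_card f (injectiveP _ inj_f); rewrite !card_ord ltnn.
case/injectivePn => i1 [i2 ne12 f12].
transitivity ((\det (\matrix_(i, j) C j (f i))) *: \prod_(i < k.+1) (x i * b (f i))).
  rewrite scaler_suml; apply: eq_bigr => s _.
  under [in RHS]eq_bigr => i _ do rewrite mxE.
  by rewrite !mulr_sign; case: ifP => _ //; rewrite scaleNr.
rewrite (determinant_alternate ne12) ?scale0r // => j.
by rewrite !mxE f12.
Qed.

End Capelli.

(** * Comparison of the two algebras *)

(** Self-adjointness bounds the degree of the minimal polynomial by [k], and reduction of [X^i]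
    modulo it leaves only the first [k] powers. *)
Lemma self_adjoint_powers (K : closedFieldType) n k (y T : 'M[K]_n) :
  2%:R != 0 :> K -> T \in unitmx -> T^T = - T -> y *m T = T *m y^T ->
  (n <= k + k)%N ->
  exists C : 'M[K]_(k.+1, k), forall i : 'I_k.+1,
    y ^+ i = \sum_j C i j *: y ^+ j.
Proof.
move=> two0; case: n y T => [|n] y T unitT skT yT lenk.
  by exists 0 => i; rewrite [LHS]thinmx0 [RHS]thinmx0.
have le_dk : (degree_mxminpoly y <= k)%N.
  have := leq_trans (degree_mxminpoly_self_adjoint two0 unitT skT yT) lenk.
  by rewrite !addnn leq_double.
pose q i : {poly K} := 'X^i %% mxminpoly y.
exists (\matrix_(i, j) (q i)`_j) => i.
have -> : y ^+ i = horner_mx y (q i).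
  have /(congr1 (horner_mx y)) := divp_eq 'X^i (mxminpoly y).
  rewrite rmorphD rmorphM /= mx_root_minpoly mulr0 add0r rmorphXn /=.
  by rewrite horner_mx_X.
have /poly_rV_K qE := leq_trans (size_mod_mxminpoly y 'X^i) le_dk.
rewrite -/(q i) in qE.
rewrite -{1}qE (row_sum_delta (poly_rV (q i))) linear_sum rmorph_sum /=.
apply: eq_bigr => j _; rewrite linearZ /= horner_mxZ rVpoly_delta !mxE rmorphXn /=.
by rewrite horner_mx_X.
Qed.

Section MatrixRepresentation.
Variables (K : fieldType) (A : falgType K) (n : nat).
Variable rho : {linear A -> 'M[K]_n}.
Hypotheses (rho_bij : bijective rho)
  (rhoM : forall a b, rho (a * b) = rho a *m rho b).

Lemma matrix_rmorphism : exists phi : {rmorphism A -> 'M[K]_n}, phi =1 rho.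
Proof.
have [g rhoK gK] := rho_bij.
have rho1 : rho 1 = 1%:M.
  by rewrite -[LHS]mulmx1 -[X in _ *m X]gK -rhoM mul1r gK.
have rho_mul : multiplicative rho by split.
by exists (HB.pack_for {rmorphism A -> 'M[K]_n} (GRing.Linear.sort rho)
  (GRing.isMultiplicative.Build _ _ (GRing.Linear.sort rho) rho_mul)).
Qed.

Lemma capelli_powers_matrix k x y :
  rho (capelli_powers k x y) = capelli_powers k (rho \o x) (rho y).
Proof.
have [phi phiE] := matrix_rmorphism.
rewrite -!phiE rmorph_capelli_powers; apply: eq_capelli_powers => i.
by rewrite /= phiE.
Qed.

End MatrixRepresentation.

(* With matrix units as separators the sum collapses to a Vandermonde
   determinant. *)
Lemma capelli_powers_diagonalizable (K : fieldType) n k (iota : 'I_k.+1 -> 'I_n)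
    (d : 'rV[K]_n) (y P : 'M[K]_n) :
  P \in unitmx -> y *m P = P *m diag_mx d -> injective (fun i => d 0 (iota i)) ->
  exists x : nat -> 'M[K]_n, capelli_powers k.+1 x y != 0.
Proof.
case: n iota d y P => [|n] iota d y P unitP yP d_inj; first by case: (iota ord0).
pose ii i : 'I_n.+1 := iota (inord i).
(* Matrix units in an eigenbasis of [y]: multiplying [E i j] by [y] on the right scales it by
   [d 0 j]. *)
pose E i j : 'M[K]_n.+1 := P *m delta_mx i j *m invmx P.
have EM i j l : E i j *m E j l = E i l.
  by rewrite /E !mulmxA mulmxKV // -[P *m _ *m _]mulmxA mul_delta_mx.
have Ey i j e : E i j *m y ^+ e = d 0 j ^+ e *: E i j.
  have Py : invmx P *m y = diag_mx d *m invmx P.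
    by rewrite -[LHS](mulmxK unitP) -(mulmxA (invmx P)) yP mulKmx.
  have Ey1 : E i j *m y = d 0 j *: E i j.
    have dE : delta_mx i j *m diag_mx d = d 0 j *: delta_mx i j :> 'M[K]_n.+1.
      apply/matrixP => a b; rewrite mul_mx_diag !mxE mulrC.
      by have [->|nbj] := eqVneq b j; rewrite // andbF !mulr0.
    rewrite /E -mulmxA Py mulmxA -(mulmxA P) dE.
    by rewrite -scalemxAr -scalemxAl.
  elim: e => [|e IHe]; first by rewrite mulmx1 scale1r.
  by rewrite exprS -mulmxE mulmxA Ey1 -scalemxAl IHe scalerA -exprS.
(* As [0.-1 = 0], the chain starts with the idempotent [E (ii 0) (ii 0)], and the products
   telescope. *)
pose x i := E (ii i.-1) (ii i).
have prodx j : \prod_(i < j.+1) x i = E (ii 0%N) (ii j).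
  elim: j => [|j IHj]; first by rewrite big_ord1.
  by rewrite big_ord_recr /= IHj -mulmxE EM.
pose a : 'rV[K]_k.+1 := \row_i d 0 (iota i).
exists x.
have -> : capelli_powers k.+1 x y =
    \det (Vandermonde k.+1 a)^T *: E (ii 0%N) (ii k).
  rewrite scaler_suml; apply: eq_bigr => s _.
  have -> : \prod_(i < k.+1) (x i * y ^+ s i) =
      (\prod_(i < k.+1) (Vandermonde k.+1 a)^T i (s i)) *: E (ii 0%N) (ii k).
    rewrite -prodx -scaler_prod; apply: eq_bigr => i _.
    by rewrite -mulmxE Ey !mxE /x /ii inord_val.
  by rewrite !mulr_sign; case: ifP => _ //; rewrite scaleNr.
rewrite scaler_eq0 negb_or det_tr det_Vandermonde; apply/andP; split.
  apply/prodf_neq0 => i _; apply/prodf_neq0 => j ltij.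
  rewrite !mxE subr_eq0; apply: contraTneq ltij => /d_inj ->.
  by rewrite ltnn.
apply/eqP => E0.
have : delta_mx (ii 0%N) (ii k) = 0 :> 'M[K]_n.+1.
  by rewrite -[LHS](mulKmx unitP) -[P *m delta_mx _ _](mulmxKV unitP) -/(E _ _)
     E0 mul0mx mulmx0.
move/matrixP/(_ (ii 0%N) (ii k)); rewrite !mxE !eqxx => /eqP.
by rewrite oner_eq0.
Qed.

Lemma exists_distinct_row (K : closedFieldType) m :
  exists d : 'rV[K]_m, injective (d 0).
Proof.
suff [s us ss] : exists2 s : seq K, uniq s & size s = m.
  exists (\row_i s`_i) => i j; rewrite !mxE => /eqP.
  by rewrite nth_uniq ?ss // => /eqP/val_inj.
elim: m => [|m [s us ss]]; first by exists [::].
have : \prod_(z <- s) ('X - z%:P) != 0 by rewrite monic_neq0 ?monic_prod_XsubC.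
case/closed_nonrootP => z; rewrite root_prod_XsubC => zs.
by exists (z :: s); rewrite /= ?zs ?ss.
Qed.

(* [D^T *m invmx T *m D = invmx G] makes [D] an isometry onto a nondegenerate
   subspace, and [sigma] is transported to it by zero on the complement. *)
Lemma symplectic_embedding (K : fieldType) (A : falgType K)
    (star : {linear A -> A}) n k (sigma : {linear A -> 'M[K]_n}) (G : 'M[K]_n) :
  2%:R != 0 :> K -> injective sigma ->
  (forall a b, sigma (a * b) = sigma a *m sigma b) ->
  G \in unitmx -> G^T = - G -> (forall a, sigma (star a) *m G = G *m (sigma a)^T) ->
  (n <= k + k)%N ->
  exists psi : {linear A -> 'M[K]_(k + k)},
    [/\ injective psi, forall a b, psi (a * b) = psi a *m psi b &
        forall a, psi (star a) = symplectic_inv (psi a)].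
Proof.
move=> two0 sigma_inj sigmaM unitG skG sigmaG lenk.
set T := symplectic_T (K := K) k.
have trT : T^T = - T := tr_symplectic_T K k.
have TT : T *m T = - 1%:M := symplectic_T_sqr K k.
have invT : invmx T = - T := symplectic_T_inv K k.
(* The Gram matrix to realize is [- invmx G], with a sign because [invmx T = - T]. *)
have skGV : (- invmx G)^T = - (- invmx G).
  have GVG : (invmx G)^T *m G = - 1%:M.
    by rewrite -{2}[G]opprK -skG mulmxN -trmx_mul mulmxV // trmx1.
  by rewrite linearN /= -[(invmx G)^T](mulmxK unitG) GVG mulNmx mul1mx.
have [|u [v GE]] := alternating_sum_hyperbolic two0 (k := k) skGV.
  by apply: leq_trans lenk; rewrite -[X in (_ <= X)%N]card_ord max_card.
pose D := col_mx u v.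
have DTD : D^T *m T *m D = - invmx G by rewrite symplectic_T_gram GE.
(* The adjoint of [D] for the two forms, a left inverse because [D] is an isometry. *)
pose D' := - (G *m D^T *m T).
have D'D : D' *m D = 1%:M.
  by rewrite mulNmx -!mulmxA (mulmxA D^T) DTD mulmxN opprK mulmxV.
have psi_lin : linear (fun a => D *m sigma a *m D').
  by move=> c a b; rewrite linearP mulmxDr mulmxDl -scalemxAr -scalemxAl.
have [psi psiE] := linear_pack psi_lin.
exists psi; split=> [a b|a b|a]; rewrite ?psiE.
- move=> ab; apply: sigma_inj.
  have cancel_psi M : D' *m (D *m M *m D') *m D = M.
    by rewrite !mulmxA D'D mul1mx -mulmxA D'D mulmx1.
  by rewrite -[LHS]cancel_psi ab cancel_psi.
- by rewrite sigmaM !mulmxA -(mulmxA _ D' D) D'D mulmx1.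
have D'T : D'^T = - (T *m D *m G).
  by rewrite [LHS]raddfN /= !trmx_mul trmxK trT skG !(mulmxN, mulNmx, opprK) ?mulmxA.
rewrite /symplectic_inv -/T invT !trmx_mul D'T.
rewrite !(mulmxN, mulNmx, opprK) !mulmxA TT !(mulmxN, mulNmx, opprK) mul1mx.
by rewrite -(mulmxA D G) -sigmaG !mulmxA.
Qed.

Theorem theorem7 (K : closedFieldType) (A B : falgType K)
    (starA : {linear A -> A}) (starB : {linear B -> B})
    (char_ne2 : 2%N \notin [pchar K])
    (csA : central_simple A) (csB : central_simple B)
    (invA : is_involution starA) (invB : is_involution starB)
    (sympB : symplectic_type starB)
    (idBA : forall f : freeYZ K, star_identity starB f -> star_identity starA f) :
  exists phi : {linear A -> B},
    is_embedding phi /\ involution_preserving starA starB phi.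
Proof.
have two0 : 2%:R != 0 :> K by apply: contraNN char_ne2 => /eqP E; rewrite inE E eqxx.
have [k [_ [phiB [phiB_bij phiBM phiBstar]]]] := sympB.
have [starAM starAK] := invA; have [_ starBK] := invB.
have [_ simpleA] := csA.
have [n [rho [n_gt0 rho_bij rhoM]]] := simple_algebra_matrix simpleA.
have [g rhoK gK] := rho_bij.
have g_lin : linear g.
  by move=> c a b; apply: (can_inj rhoK); rewrite linearP !gK.
have tau_lin : linear (fun M => rho (starA (g M))).
  by move=> c a b; rewrite g_lin !linearP.
have [tau tauE] := linear_pack tau_lin.
have gM a b : g (a *m b) = g a * g b.
  by apply: (can_inj rhoK); rewrite rhoM !gK.
have [|||H [unitH tauH symH]] := @matrix_involution_adjoint K n tau.
- by move=> a b; rewrite !tauE gM starAM rhoM.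
- by move=> a; rewrite !tauE rhoK starAK gK.
- by [].
have starH a : rho (starA a) *m H = H *m (rho a)^T.
  by rewrite -tauH tauE rhoK.
(* Symmetric elements of [B] are self-adjoint for [T], so their first [k.+1] powers are spanned by
   the first [k]. *)
have capB : star_identity starB (capelli_identity K k.+1).
  apply/star_identity_capelli => // x y sy.
  set T := symplectic_T (K := K) k.
  have unitT : T \in unitmx := symplectic_T_unit K k.
  have yT : phiB y *m T = T *m (phiB y)^T.
    by rewrite -{1}sy phiBstar /symplectic_inv mulmxKV.
  have [C CP] := self_adjoint_powers two0 unitT (tr_symplectic_T K k) yT (leqnn _).
  apply: (@capelli_powers_dependent K B k x y (fun j => y ^+ j) C) => i.
  have [psi psiE] := matrix_rmorphism phiB_bij phiBM.
  have phiBX e : phiB (y ^+ e) = phiB y ^+ e by rewrite -!psiE rmorphXn.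
  apply: (bij_inj phiB_bij); rewrite linear_sum phiBX CP.
  by apply: eq_bigr => j _; rewrite linearZ /= phiBX.
have capA y : starA y = y -> forall x, capelli_powers k.+1 x y = 0.
  move=> sy x; have /star_identity_capelli := idBA _ capB.
  by move=> ->.
(* The Capelli identity excludes a diagonalizable symmetric element with more than [k] distinct
   eigenvalues; [iota] selects [k.+1] of them. *)
have no_diag (d : 'rV[K]_n) (iota : 'I_k.+1 -> 'I_n) P : P \in unitmx ->
    injective (fun i => d 0 (iota i)) ->
    P *m diag_mx d *m invmx P *m H = H *m (P *m diag_mx d *m invmx P)^T -> False.
  move=> unitP d_inj yH; set Y := _ *m invmx P in yH.
  have YP : Y *m P = P *m diag_mx d by rewrite mulmxKV.
  have [x /eqP []] := capelli_powers_diagonalizable unitP YP d_inj.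
  have /capA /(_ (g \o x)) : starA (g Y) = g Y.
    apply: (can_inj rhoK); apply: (can_inj (mulmxK unitH)).
    by rewrite starH !gK.
  move/(congr1 rho); rewrite (capelli_powers_matrix rho_bij rhoM) linear0 gK.
  by move=> <-; apply: eq_capelli_powers => i; rewrite /= gK.
(* Composition with the inverse of [phiB] reduces the target to the standard symplectic matrix
   algebra. *)
suff [psi [psi_inj psiM psi_star]] : exists psi : {linear A -> 'M[K]_(k + k)},
    [/\ injective psi, forall a b, psi (a * b) = psi a *m psi b &
        forall a, psi (starA a) = symplectic_inv (psi a)].
  have [h phiBK hK] := phiB_bij.
  have [|phi phiE] := @linear_pack _ _ _ (fun a => h (psi a)).
    by move=> c a b; apply: (can_inj phiBK); rewrite hK [RHS]linearP /= !hK linearP.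
  exists phi; split; [split=> [a b|a b]|move=> a]; rewrite !phiE.
  - by move/(congr1 phiB); rewrite !hK; apply: psi_inj.
  - by apply: (can_inj phiBK); rewrite phiBM !hK psiM.
  - by apply: (can_inj phiBK); rewrite phiBstar !hK psi_star.
case: symH => symH.
  (* Orthogonal type: when [H = U^T *m U], conjugating any diagonal matrix by [U^T] gives a
     self-adjoint one, so all [n] eigenvalues can be distinct. *)
  have le_nk : (n <= k)%N.
    rewrite leqNgt; apply/negP => lt_kn.
    have [U HU] := symmetric_gram two0 symH (rank_leq_row H).
    have unitU : U \in unitmx.
      by move: unitH; rewrite HU unitmx_mul => /andP [].
    have [d d_inj] := exists_distinct_row K n.
    apply: (@no_diag d (widen_ord lt_kn) U^T); rewrite ?unitmx_tr //.
      by move=> i j /d_inj /(congr1 val) /= /val_inj.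
    rewrite !trmx_mul tr_diag_mx trmxK trmx_inv HU.
    by rewrite !mulmxA mulmxKV ?unitmx_tr // trmxK mulmxK.
  (* Two diagonal copies of [rho] turn the symmetric form into an alternating one on [K^n + K^n], of
     dimension at most [2k]. *)
  pose sg a := block_mx (rho a) 0 0 (rho a).
  have sg_lin : linear sg.
    by move=> c a b; rewrite /sg linearP scale_block_mx add_block_mx !scaler0 !addr0.
  have [sigma sigmaE] := linear_pack sg_lin.
  apply: (@symplectic_embedding _ _ _ _ _ sigma (block_mx 0 H (- H) 0)) => //.
  - by move=> a b; rewrite !sigmaE => /eq_block_mx [/(can_inj rhoK)].
  - move=> a b; rewrite !sigmaE /sg mulmx_block rhoM.
    by rewrite !mulmx0 !mul0mx !addr0 !add0r.
  - suff /mulmx1_unit [] : block_mx 0 H (- H) 0 *m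
        block_mx 0 (- invmx H) (invmx H) 0 = 1%:M by [].
    rewrite mulmx_block !mulmx0 !mul0mx !addr0 !add0r mulNmx mulmxN opprK.
    by rewrite mulmxV // -scalar_mx_block.
  - by rewrite tr_block_mx opp_block_mx !trmx0 !oppr0 linearN /= symH opprK.
  - move=> a; rewrite !sigmaE /sg tr_block_mx !mulmx_block !trmx0.
    by rewrite !mulmx0 !mul0mx !addr0 !add0r !mulmxN !mulNmx starH.
  - exact: leq_add.
(* Symplectic type: [H] is already alternating, and it remains to bound [n] by [2k]. *)
apply: (@symplectic_embedding _ _ _ _ _ rho H) => //; first exact: can_inj rhoK.
rewrite leqNgt; apply/negP => lt_kn.
(* In odd size a skew matrix satisfies [det H = - det H], so it is singular. *)
have n_even : n = (n./2 + n./2)%N.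
  rewrite addnn -[LHS]odd_double_half; case: (boolP (odd n)) => // n_odd.
  have : \det H = - \det H.
    by rewrite -{1}det_tr symH -scaleN1r detZ -signr_odd n_odd mulN1r.
  move/(oppr_fix_eq0 two0) => det0.
  by move: unitH; rewrite unitmxE det0 unitr0.
move: (n./2) n_even => m n_even.
subst n.
have [|u [v HE]] := alternating_sum_hyperbolic two0 (k := m) symH.
  by rewrite -[X in (_ <= X)%N]card_ord max_card.
set T := symplectic_T (K := K) m; pose D := col_mx u v.
have {}HE : H = D^T *m T *m D by rewrite symplectic_T_gram HE.
have unitD : D \in unitmx.
  by move: unitH; rewrite HE unitmx_mul => /andP [].
have lt_km : (k < m)%N by rewrite -ltn_double -!addnn.
have [d d_inj] := exists_distinct_row K m.
(* Each eigenvalue is doubled so that the diagonal matrix commutes with [T]; this leaves [m]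
   distinct ones, more than [k]. *)
apply: (@no_diag (row_mx d d) (fun i => lshift m (widen_ord lt_km i)) D^T).
- by rewrite unitmx_tr.
- by move=> i j; rewrite !row_mxEl => /d_inj /(congr1 val) /= /val_inj.
rewrite !trmx_mul tr_diag_mx trmxK trmx_inv HE.
rewrite !mulmxA mulmxKV ?unitmx_tr // trmxK mulmxK //; congr (_ *m _).
rewrite -!mulmxA; congr (_ *m _).
rewrite diag_mx_row /T symplectic_T_block !mulmx_block.
by rewrite !mulmx0 !mul0mx !addr0 !add0r mulmxN mulNmx !mulmx1 !mul1mx.
Qed.
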